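(* Let $X_1,X_2,\dots$ be independent identically distributed random vectors in $\mathbb R^2$ and $S_k:=X_1+\dots+X_k$, $k\ge 1$. Assume that $\mathbb P(X_1\in h)=0$ for every affine line $h\subset\mathbb R^2$, and that $X_1\overset{d}{=}-X_1$. Then for every $n\ge 1$, $$\mathbb P\bigl(0\notin \operatorname{conv}(S_1,\dots,S_n)\bigr)=\sum_{k=1}^n\frac{(2n-2k-1)!!}{k\cdot(2n-2k)!!}.$$
   Context: $\operatorname{conv}$ denotes the convex hull. Double factorials: $(2m-1)!!=1\cdot3\cdots(2m-1)$ and $(2m)!!=2\cdot4\cdots(2m)$ for $m\ge1$, with $(-1)!!=0!!=1$. The symbol $\overset{d}{=}$ means equality in distribution. *)

(* Defs.v *)
From HB Require Import structures.
From mathcomp Require Import all_boot all_order all_algebra finmap.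
From mathcomp Require Import all_classical all_reals all_analysis.

Set Implicit Arguments.
Unset Strict Implicit.
Unset Printing Implicit Defensive.

Import Order.TTheory GRing.Theory Num.Theory.
Import numFieldNormedType.Exports.

Local Open Scope classical_set_scope.
Local Open Scope ring_scope.

Definition convex_hull (R : numDomainType) (V : lmodType R) (A : set V) : set V :=
  smallest (@convex_set R V) A.

Definition affine_line (R : realType) (h : set (R * R)) : Prop :=
  exists p v : R * R, v != 0 /\ h = [set p + t *: v | t in [set: R]].

(* Mutual independence: product rule over every finite subfamily. *)
Definition independent_RVs d d' (T : measurableType d) (T' : measurableType d')
    (R : realType) (P : probability T R) (I : choiceType)
    (X : I -> {RV P >-> T'}) : Prop :=
  forall (J : {fset I}) (A : I -> set T'), (forall i, measurable (A i)) ->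
    P (\bigcap_(i in [set` J]) (X i @^-1` A i)) =
    (\prod_(i <- J) P (X i @^-1` A i))%E.

(* Stated for plain functions so that it applies to [- X] without a
   measurable-function structure on it; only measurable [A] are quantified over
   because [P] is unconstrained off the sigma-algebra. *)
Definition equal_in_distribution d d' (T : measurableType d)
    (T' : measurableType d') (R : realType) (P : probability T R)
    (X Y : T -> T') : Prop :=
  forall A : set T', measurable A -> P (X @^-1` A) = P (Y @^-1` A).

(* S_k = X_1 + ... + X_k, the family being indexed from 0: X_j is [X j.-1].
   On [R * R] the sigma-algebra is the product one, i.e. the Borel one. *)
Definition partial_sum d (T : measurableType d) (R : realType)
    (P : probability T R) (X : nat -> {RV P >-> (R * R)%type})
    (k : nat) (w : T) : R * R :=
  \sum_(i < k) X i w.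

(* (2m-1)!! = 1 * 3 * ... * (2m-1); the empty product gives (-1)!! = 1. *)
Definition odd_double_factorial (m : nat) : nat :=
  (\prod_(1 <= i < m.+1) (2 * i - 1))%N.

(* (2m)!! = 2 * 4 * ... * (2m). *)
Definition even_double_factorial (m : nat) : nat :=
  (\prod_(1 <= i < m.+1) (2 * i))%N.

(* Main.v *)
(* The origin is outside conv(S_1, ..., S_n) iff some S_k has all the other
   points in the open half-plane to its left or on its own ray; almost surely
   this k is unique, and then all the other points are strictly to the left.
   For fixed k this event splits into two parts. The bridge
   S_1, ..., S_(k-1) must lie to the left of S_k: exactly one of the k cyclic
   shifts of X_1, ..., X_k does this almost surely, so the probability is 1/k.
   Given S_k = v, the one-dimensional symmetric walk det(v, S_(k+j) - S_k),
   1 <= j <= n - k, must stay positive. Writing p_m for the probability that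
   such a walk of length m stays positive, a decomposition at the time of the
   minimum gives p_0 p_m + ... + p_m p_0 = 1, hence p_m = (2m-1)!!/(2m)!!. *)
Require Import Defs.
From HB Require Import structures.
From mathcomp Require Import all_boot all_order all_algebra finmap.
From mathcomp Require Import all_classical all_reals all_analysis.
From mathcomp Require Import measurable_realfun ring lra zify.

Set Implicit Arguments.
Unset Strict Implicit.
Unset Printing Implicit Defensive.

Import Order.TTheory GRing.Theory Num.Theory.
Import numFieldNormedType.Exports.

Local Open Scope classical_set_scope.
Local Open Scope ring_scope.

(** * Convex hulls of finite planar point sets *)

Section plane.
Context {R : realType}.
Implicit Types p q x y : R * R.

Definition det p q : R := p.1 * q.2 - p.2 * q.1.
Definition dot p q : R := p.1 * q.1 + p.2 * q.2.

Lemma detDr p x y : det p (x + y) = det p x + det p y.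
Proof. by rewrite /det /=; ring. Qed.

Lemma detNr p x : det p (- x) = - det p x.
Proof. by rewrite /det /=; ring. Qed.

Lemma detBr p x y : det p (x - y) = det p x - det p y.
Proof. by rewrite detDr detNr. Qed.

Lemma detC p x : det p x = - det x p.
Proof. by rewrite /det /=; ring. Qed.

Lemma detxx p : det p p = 0.
Proof. by rewrite /det /=; ring. Qed.

Lemma det0r p : det p 0 = 0.
Proof. by rewrite /det /= !mulr0 subr0. Qed.

Lemma dot_gt0 p : (0 < dot p p) = (p != 0).
Proof.
case: p => a b; rewrite /dot /= -!expr2 lt_neqAle addr_ge0 ?sqr_ge0// andbT.
by rewrite eq_sym paddr_eq0 ?sqr_ge0// !sqrf_eq0.
Qed.

(** Lagrange's identity: the squares of [det p q] and [dot p q] add up to the product of the squared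
    lengths of [p] and [q]. *)
Lemma dot_det_eq0 p q : det p q = 0 -> dot p q = 0 -> p = 0 \/ q = 0.
Proof.
case: p q => [p1 p2] [q1 q2]; rewrite /det /dot /= => h1 h2.
have : (p1 ^+ 2 + p2 ^+ 2) * (q1 ^+ 2 + q2 ^+ 2) = 0.
  transitivity ((p1 * q2 - p2 * q1) ^+ 2 + (p1 * q1 + p2 * q2) ^+ 2).
    by ring.
  by rewrite h1 h2; ring.
move=> /eqP; rewrite mulf_eq0 !paddr_eq0 ?sqr_ge0// !sqrf_eq0.
by move=> /orP[] /andP[/eqP -> /eqP ->]; [left|right].
Qed.

(* The open half-plane to the left of [p], together with the open ray of [p];
   it is convex and misses the origin. *)
Definition left_side p : set (R * R) :=
  [set x | 0 < det p x \/ det p x = 0 /\ 0 < dot p x].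

Lemma convex_left_side p : convex_set (left_side p).
Proof.
apply/convex_setW => x y /set_mem px /set_mem py k k0 k1; apply/mem_set.
have -> : conv k x y = k%:num *: (x : R * R) + (1 - k%:num) *: (y : R * R).
  by [].
move: (k%:num : R) k0 k1 => {k} k k0 k1.
have k1' : 0 < 1 - k by rewrite subr_gt0.
have detE : det p (k *: x + (1 - k) *: y) = k * det p x + (1 - k) * det p y.
  by rewrite /det /= /GRing.scale /=; ring.
have dotE : dot p (k *: x + (1 - k) *: y) = k * dot p x + (1 - k) * dot p y.
  by rewrite /dot /= /GRing.scale /=; ring.
move: px py; rewrite /left_side /= detE dotE => -[px|[-> px]] [py|[-> py]].
- by left; rewrite addr_gt0// mulr_gt0.
- by left; rewrite mulr0 addr0 mulr_gt0.
- by left; rewrite mulr0 add0r mulr_gt0.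
- by right; rewrite !mulr0 addr0 addr_gt0// mulr_gt0.
Qed.

Lemma left_side0 p : ~ left_side p 0.
Proof.
rewrite /left_side /= det0r ltxx => -[//|[_]].
by rewrite /dot /= !mulr0 addr0 ltxx.
Qed.

(** * Angular order on a convex set missing the origin *)

Section cone_free.
Variables C : set (R * R).
Hypotheses (C_convex : convex_set C) (C0 : ~ C 0).

Let conv2 x y (a b : R) : C x -> C y -> 0 <= a -> 0 <= b -> a + b = 1 ->
  C (a *: x + b *: y).
Proof.
move=> Cx Cy a0 b0 ab1.
have a1 : a <= 1 by rewrite -ab1 lerDl.
have := C_convex (Itv01 a0 a1) (mem_set Cx) (mem_set Cy) => /set_mem.
rewrite /conv /= => h.
suff -> : b = 1 - a by [].
by rewrite -ab1 addrC addKr.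
Qed.

Let convex_comb2 x y (a b : R) : C x -> C y -> 0 <= a -> 0 <= b -> 0 < a + b ->
  a *: x + b *: y != 0.
Proof.
move=> Cx Cy a0 b0 ab; apply/eqP => e; apply: C0.
have := conv2 Cx Cy (divr_ge0 a0 (ltW ab)) (divr_ge0 b0 (ltW ab)).
rewrite -mulrDl divff ?gt_eqF// => /(_ erefl).
by rewrite mulrC [b / _]mulrC -!scalerA -scalerDr e scaler0.
Qed.

Let convex_comb3 x y z (a b c : R) : C x -> C y -> C z ->
  0 <= a -> 0 <= b -> 0 < c -> a *: x + b *: y + c *: z != 0.
Proof.
move=> Cx Cy Cz a0 b0 c0.
have bc0 : 0 < b + c by rewrite ltr_wpDl.
have Cyz : C ((b / (b + c)) *: y + (c / (b + c)) *: z).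
  apply: conv2 => //; rewrite ?divr_ge0 ?(ltW bc0) ?(ltW c0)//.
  by rewrite -mulrDl divff// gt_eqF.
have := convex_comb2 Cx Cyz a0 (ltW bc0).
rewrite ltr_wpDl// => /(_ isT).
rewrite scalerDr !scalerA !mulrA ![(b + c) * _]mulrC !mulfK ?gt_eqF//.
by rewrite addrA.
Qed.

Lemma left_side_refl p : C p -> left_side p p.
Proof.
move=> Cp; right; rewrite detxx dot_gt0; split => //.
by apply/eqP => p0; apply: C0; rewrite -p0.
Qed.

(** The sign of [det p q] decides unless the two points are collinear with the origin; in that case
    opposite directions would put the origin on the segment joining them. *)
Lemma left_side_total p q : C p -> C q -> left_side p q \/ left_side q p.
Proof.
move=> Cp Cq; case: (ltgtP (det p q) 0) => pq.
- by right; left; rewrite detC oppr_gt0.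
- by left; left.
left; right; split=> //; rewrite ltNge; apply/negP => dpq.
have [e|e] : p = 0 \/ q = 0; last 2 first.
- by rewrite e in Cp.
- by rewrite e in Cq.
apply: dot_det_eq0 => //; apply/eqP; rewrite eq_le dpq /= leNgt.
apply/negP => dpq_lt.
have pp : 0 < dot p p.
  by case: (left_side_refl Cp) => [|[]//]; rewrite detxx ltxx.
(* For parallel vectors [q] is [dot p q / dot p p] times [p], so these weights, both positive here,
   give a combination that vanishes. *)
have := @convex_comb2 p q (- dot p q) (dot p p) Cp Cq.
rewrite oppr_ge0 (ltW dpq_lt) (ltW pp) addr_gt0 ?oppr_gt0// => /(_ isT isT isT).
move=> /eqP; apply.
move: pq; case: p q {Cp Cq dpq dpq_lt pp} => [p1 p2] [q1 q2].
rewrite /det /dot /= => pq.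
have e1 : - (p1 * q1 + p2 * q2) * p1 + (p1 * p1 + p2 * p2) * q1
    = - p2 * (p1 * q2 - p2 * q1) by ring.
have e2 : - (p1 * q1 + p2 * q2) * p2 + (p1 * p1 + p2 * p2) * q2
    = p1 * (p1 * q2 - p2 * q1) by ring.
by rewrite pq !mulr0 in e1 e2; congr (_, _).
Qed.

(* Any three plane vectors satisfy
   [det q r *: p + det r p *: q + det p q *: r = 0]. *)
Lemma left_side_trans p q r : C p -> C q -> C r ->
  left_side p q -> left_side q r -> left_side p r.
Proof.
move=> Cp Cq Cr pq qr; case: (left_side_total Cp Cr) => // rp.
have ge0 x y : left_side x y -> 0 <= det x y.
  by move=> [/ltW|[->]].
case: rp => [rp|[rp dotrp]]; last first.
  by right; split; [rewrite detC rp oppr0|rewrite /dot mulrC [p.2 * _]mulrC].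
have /eqP[] := convex_comb3 Cp Cr Cq (ge0 _ _ qr) (ge0 _ _ pq) rp.
case: p q r {Cp Cq Cr rp pq qr} => [p1 p2] [q1 q2] [r1 r2].
by rewrite /det; congr (_, _); rewrite /= /GRing.scale /=; ring.
Qed.

(** On [C] the relation [left_side] is a total preorder, hence has a minimum on finitely many
    points: the induction compares each new point with the previous minimum. *)
Lemma exists_leftmost (p : nat -> R * R) m : (0 < m)%N ->
  (forall j, (1 <= j <= m)%N -> C (p j)) ->
  exists2 k, (1 <= k <= m)%N &
    forall j, (1 <= j <= m)%N -> left_side (p k) (p j).
Proof.
elim: m => // -[_ _ Cp|m IH _ Cp].
  exists 1%N => // j; case: j => [|[|j]]// _.
  exact/left_side_refl/Cp.
have [//|j /andP[j1 jm]|k /andP[k1 km] kP] := IH.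
  by apply: Cp; rewrite j1 leqW.
have Ck : C (p k) by apply: Cp; rewrite k1 leqW.
have Cm : C (p m.+2) by apply: Cp; rewrite leqnn.
have [kl|lk] := left_side_total Ck Cm.
- exists k => [|j]; first by rewrite k1 leqW.
  case/andP=> j1; rewrite leq_eqVlt => /orP[/eqP ->//|jm].
  by apply: kP; rewrite j1.
- exists m.+2 => [|j]; first by rewrite leqnn.
  case/andP=> j1; rewrite leq_eqVlt => /orP[/eqP ->|jm].
    exact: left_side_refl.
  apply: left_side_trans lk _ => //; last by apply: kP; rewrite j1.
  by apply: Cp; rewrite j1 ltnW.
Qed.

End cone_free.

(** A convex set containing the points but not the origin carries the angular order, whose minimum
    is the wanted [p k]; conversely [left_side (p k)] is itself such a convex set. *)
Lemma not_convex_hull0P (p : nat -> R * R) m : (0 < m)%N ->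
  ~ convex_hull [set p k | k in [set k | (1 <= k <= m)%N]] 0 <->
  exists2 k, (1 <= k <= m)%N &
    forall j, (1 <= j <= m)%N -> left_side (p k) (p j).
Proof.
move=> m0; split => [/existsNP[C /not_implyP[[C_convex pC] C0]]|[k km kP] hull0].
  apply: (@exists_leftmost C) => // j jm.
  by apply: pC; exists j.
apply: (@left_side0 (p k)); apply: hull0; split; first exact: convex_left_side.
by move=> _ [j jm <-]; exact: kP.
Qed.

End plane.

(** * The ratio of double factorials *)

Section double_factorial_ratio.
Context {F : realFieldType}.

Definition dfact_ratio (m : nat) : F :=
  (odd_double_factorial m)%:R / (even_double_factorial m)%:R.

Lemma dfact_ratio0 : dfact_ratio 0 = 1.
Proof.
by rewrite /dfact_ratio /odd_double_factorial /even_double_factorial !big_geq// divr1.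
Qed.

Lemma dfact_ratioS m :
  2 * m.+1%:R * dfact_ratio m.+1 = (2 * m%:R + 1) * dfact_ratio m.
Proof.
rewrite /dfact_ratio /odd_double_factorial /even_double_factorial.
rewrite !(big_nat_recr m.+1)//= (_ : (2 * m.+1 - 1 = 2 * m + 1)%N); last by lia.
have : ((\prod_(1 <= i < m.+1) (2 * i))%N)%:R != 0 :> F.
  rewrite pnatr_eq0 -lt0n big_seq prodn_cond_gt0// => i.
  by rewrite mem_index_iota => /andP[i0 _]; rewrite muln_gt0.
rewrite !natrM natrD natrM.
set a := (\prod_(_ <= _ < _) _)%:R; set b := _%:R => b0.
have m1 : m.+1%:R != 0 :> F by rewrite pnatr_eq0.
by field; rewrite -natr1 in m1; rewrite b0 ?m1 addrC.
Qed.

Lemma sum_rev (f : nat -> nat -> F) m :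
  \sum_(r < m.+1) f r (m - r)%N = \sum_(r < m.+1) f (m - r)%N r.
Proof.
rewrite (reindex_inj rev_ord_inj)/=; apply: eq_bigr => r _.
by rewrite subSS subKn// -ltnS.
Qed.

(* With [a m] the left-hand side, symmetrizing the weights [r] and [m - r] and
   applying the recurrence [dfact_ratioS] gives [(m + 1) a (m + 1) = (m + 1) a m]. *)
Lemma dfact_ratio_conv m :
  \sum_(r < m.+1) dfact_ratio r * dfact_ratio (m - r) = 1.
Proof.
pose q := dfact_ratio; rewrite -/q.
have weight k : 2 * \sum_(r < k.+1) r%:R * (q r * q (k - r)%N) =
    k%:R * \sum_(r < k.+1) q r * q (k - r)%N.
  rewrite mulr2n mulrDl mul1r.
  rewrite {1}(sum_rev (fun r s => r%:R * (q r * q s))) -big_split mulr_sumr /=.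
  by apply: eq_bigr => r _; rewrite natrB -1?ltnS//; ring.
elim: m => [|m IH].
  by rewrite big_ord_recl big_ord0 subn0 addr0 /q dfact_ratio0 mulr1.
have m1 : m.+1%:R != 0 :> F by rewrite pnatr_eq0.
apply: (mulfI m1); rewrite -weight big_ord_recl mul0r add0r mulr_sumr.
transitivity (2 * (\sum_(r < m.+1) r%:R * (q r * q (m - r)%N)) +
    \sum_(r < m.+1) q r * q (m - r)%N); last first.
  by rewrite weight IH -natr1; ring.
rewrite mulr_sumr -big_split; apply: eq_bigr => r _ /=.
rewrite /bump /= add1n subSS; have := dfact_ratioS r; rewrite -/(q _) -/(q _) => e.
by rewrite 2!mulrA e; ring.
Qed.

(** For positive [m] the identity contains [p m] only in its two end terms, each equal to [p m]
    because [p 0 = 1], so the smaller values determine it. *)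
Lemma dfact_ratio_unique (p : nat -> F) : p 0%N = 1 ->
  (forall m, (0 < m)%N -> \sum_(r < m.+1) p r * p (m - r)%N = 1) ->
  forall m, p m = dfact_ratio m.
Proof.
move=> p0 pS; elim/ltn_ind => -[|m] IH; first by rewrite p0 dfact_ratio0.
have := pS m.+1 isT; rewrite -(dfact_ratio_conv m.+1).
have ends (f : nat -> F) : \sum_(r < m.+2) f r =
    f 0%N + (\sum_(r < m) f r.+1 + f m.+1).
  by rewrite big_ord_recl big_ord_recr.
rewrite (ends (fun r => p r * p (m.+1 - r)%N)).
rewrite (ends (fun r => dfact_ratio r * dfact_ratio (m.+1 - r))).
rewrite subn0 subnn p0 dfact_ratio0.
rewrite (eq_bigr (fun r : 'I_m => dfact_ratio r.+1 * dfact_ratio (m.+1 - r.+1))).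
  by lra.
by move=> r _; rewrite !IH//; have := ltn_ord r; lia.
Qed.

End double_factorial_ratio.

(** * Laws of finite samples *)

HB.instance Definition _ (T : choiceType) := isPointed.Build (seq T) [::].

Section trajectories.
Context d (V : measurableType d).

(* Sequences are padded with [point], so the sigma-algebra generated by the
   boxes does not see lengths and one type serves samples of every size. *)
Definition box (A : nat -> set V) : set (seq V) :=
  [set x | forall i, A i (nth point x i)].

Definition boxes : set (set (seq V)) :=
  [set box A | A in [set A | forall i, measurable (A i)]].

Definition trajectory := g_sigma_algebraType boxes.

Lemma boxes_setI : setI_closed boxes.
Proof.
move=> _ _ [A mA <-] [B mB <-]; exists (fun i => A i `&` B i).
  by move=> i; exact: measurableI.
apply/seteqP; split => [x xAB|x [xA xB] i]; last by split.
by split => i; have [] := xAB i.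
Qed.

Lemma measurable_box A : (forall i, measurable (A i)) ->
  measurable (box A : set trajectory).
Proof. by move=> mA; apply: sub_sigma_algebra; exists A. Qed.

Lemma measurable_nth i :
  measurable_fun [set: trajectory] (fun x : trajectory => nth point x i).
Proof.
move=> _ B mB; rewrite setTI.
rewrite (_ : _ @^-1` _ = box (fun j => if j == i then B else setT)).
  by apply: measurable_box => j; case: ifP.
apply/seteqP; split => x /= xB => [j|]; first by case: eqP => [->|].
by have := xB i; rewrite eqxx.
Qed.

Lemma measurable_trajectory d' (T : measurableType d') (f : T -> trajectory) :
  (forall i, measurable_fun setT (fun w => nth point (f w) i)) ->
  measurable_fun setT f.
Proof.
move=> mf; apply: (@measurability _ _ T trajectory setT f boxes erefl) => _ [_ [A mA <-] <-].
rewrite setTI (_ : _ @^-1` _ =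
    \bigcap_i ((fun w => nth point (f w) i) @^-1` A i)).
  apply: bigcap_measurable => [|i _]; first by exists 0%N.
  by rewrite -[X in measurable X]setTI; exact: mf.
by apply/seteqP; split => w /= wA => [i _|i]; exact: wA.
Qed.

(** The boxes form an intersection-stable generating class that contains the whole space, so they
    determine a finite measure. *)
Lemma trajectory_measure_unique (R : realType)
    (m1 m2 : {measure set trajectory -> \bar R}) :
  (m1 setT < +oo)%E ->
  (forall A, (forall i, measurable (A i)) -> m1 (box A) = m2 (box A)) ->
  forall B, measurable B -> m1 B = m2 B.
Proof.
move=> m1oo m12 B mB; apply: (@measure_unique _ R trajectory boxes (fun=> setT) erefl boxes_setI) => //.
- by move=> _; exists (fun=> setT) => //; apply/seteqP; split.
- by rewrite bigcup_const//; exists 0%N.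
- by move=> _ [A mA <-]; exact: m12.
Qed.

End trajectories.

(** * Independence of two random elements and conditioning *)

Section independence.
Context d (T : measurableType d) (R : realType) (P : probability T R).
Local Open Scope ereal_scope.

Definition independent2 d1 d2 (T1 : measurableType d1) (T2 : measurableType d2)
    (U : T -> T1) (W : T -> T2) :=
  forall A B, measurable A -> measurable B ->
    P (U @^-1` A `&` W @^-1` B) = P (U @^-1` A) * P (W @^-1` B).

Lemma measurable_preimage d1 (T1 : measurableType d1) (U : {mfun T >-> T1}) A :
  measurable A -> measurable (U @^-1` A).
Proof. by move=> mA; rewrite -[X in measurable X]setTI; exact: measurable_funPT. Qed.

(** Both sides, as functions of [D], are finite measures: the image under [U] of [P] restricted to
    [C], and the law of [U] scaled by [P C]. Agreement on boxes therefore suffices. *)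
Let independent_box1 d1 (V : measurableType d1)
    (U : {mfun T >-> trajectory V}) (C : set T) : measurable C ->
  (forall A, (forall i, measurable (A i)) ->
     P (U @^-1` box A `&` C) = P (U @^-1` box A) * P C) ->
  forall D, measurable D -> P (U @^-1` D `&` C) = P (U @^-1` D) * P C.
Proof.
move=> mC indep D mD.
have PCfin : P C \is a fin_num by exact: fin_num_measure.
pose m1 := [the {measure set _ -> \bar R} of pushforward (mrestr P mC) U].
have PC0 : (0 <= fine (P C))%R by exact: fine_ge0.
pose m2 := [the {measure set _ -> \bar R} of
  mscale (NngNum PC0) (distribution P U)].
have m2E A : m2 A = P (U @^-1` A) * P C.
  by rewrite /m2 /= /mscale /= fineK// muleC.
rewrite -m2E -[LHS]/(m1 (measurable_funPT U) D); apply: trajectory_measure_unique => //.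
  rewrite /m1 /= /pushforward /mrestr preimage_setT setTI.
  by rewrite -ge0_fin_numE.
by move=> A mA; rewrite m2E -indep.
Qed.

(** The extension from boxes to measurable sets is made one factor at a time, first for [W], then
    for [U]. *)
Lemma independent_boxes d1 d2 (V1 : measurableType d1) (V2 : measurableType d2)
    (U : {mfun T >-> trajectory V1}) (W : {mfun T >-> trajectory V2}) :
  (forall A B, (forall i, measurable (A i)) -> (forall i, measurable (B i)) ->
    P (U @^-1` box A `&` W @^-1` box B) =
    P (U @^-1` box A) * P (W @^-1` box B)) ->
  independent2 U W.
Proof.
move=> indep A B mA mB.
rewrite setIC muleC; apply: independent_box1 => //.
  exact: measurable_preimage.
move=> B' mB'; rewrite setIC muleC; apply: independent_box1 => //.
  by apply: measurable_preimage; exact: measurable_box.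
by move=> A' mA'; exact: indep.
Qed.

Section conditioning.
Context d1 d2 (T1 : measurableType d1) (T2 : measurableType d2).
Variables (U : {mfun T >-> T1}) (W : {mfun T >-> T2}).
Hypothesis indep : independent2 U W.

Let UW w : T1 * T2 := (U w, W w).
Let mUW : measurable_fun setT UW. Proof. exact: measurable_fun_pair. Qed.
HB.instance Definition _ := isMeasurableFun.Build _ _ _ _ UW mUW.

(** Conditioning on [U]: by independence the joint law is a product measure, so it integrates the
    probabilities of the sections, which all equal [q] over [A]. *)
Lemma independent_condition (A : set T1) (D : set (T1 * T2)) (q : \bar R) :
  measurable A -> measurable D ->
  (forall x, A x -> P [set w | D (x, W w)] = q) ->
  P [set w | A (U w) /\ D (U w, W w)] = q * P (U @^-1` A).
Proof.
move=> mA mD DE.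
(* Intersecting with the cylinder over [A] empties the sections outside [A], so the section
   probabilities become [q] times the indicator of [A]. *)
pose D' := D `&` (A `*` setT).
have mD' : measurable D' by apply: measurableI => //; exact: measurableX.
transitivity (distribution P UW D').
  rewrite /distribution /pushforward /D'; congr (P _).
  by apply/seteqP; split => w /= [] => [wA wD|wD [wA _]].
rewrite -(@product_measure_unique _ _ _ _ _ (distribution P U) (distribution P W))//.
rewrite /product_measure1 /=.
rewrite (_ : (fun _ => _) = (fun x => q * (\1_A x)%:E)); last first.
  apply/funext => x; rewrite indicE; have [xA|xA] := boolP (x \in A).
    rewrite mule1 -(DE x (set_mem xA)) xsectionE; congr (P _).
    apply/seteqP; split => w; first by case.
    by split=> //; move: xA => /set_mem.
  rewrite mule0 -(measure0 P) xsectionE; congr (P _).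
  by apply/seteqP; split => w // [_ [/mem_set]]; rewrite (negbTE xA).
(* A point of [A] shows that [q] is nonnegative, which is required to pull it out of the
   integral. *)
have [->|/set0P[x Ax]] := eqVneq A set0.
  rewrite preimage_set0 measure0 mule0 integral0_eq// => x _.
  by rewrite indicE in_set0 mule0.
have q0 : 0 <= q by rewrite -(DE x Ax).
rewrite ge0_integralZl//.
- by rewrite integral_indic// setIT.
- exact/measurable_EFinP/measurable_indic.
Qed.

End conditioning.
End independence.

(** * Independent identically distributed families and their samples *)

Section iid_families.
Context d (T : measurableType d) (R : realType) (P : probability T R).
Context d' (V : measurableType d').
Local Open Scope ereal_scope.

(** One product rule encodes both properties: a singleton [s] makes [mu] the law of each [Y i] on
    measurable sets, and longer lists give independence. *)
Definition iid (mu : set V -> \bar R) (Y : nat -> T -> V) :=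
  forall s A, uniq s -> (forall i, measurable (A i)) ->
    P [set w | {in s, forall i, A i (Y i w)}] = \prod_(i <- s) mu (A i).

(** The order of [s] is the order of the steps, so reversed and rotated walks are samples along a
    reversed or rotated index list. *)
Definition sample (Y : nat -> T -> V) (s : seq nat) (w : T) : trajectory V :=
  [seq Y i w | i <- s].

Section measurable_sample.
Variables (Y : nat -> {mfun T >-> V}) (s : seq nat).

Lemma measurable_sample : measurable_fun setT (sample Y s).
Proof.
apply: measurable_trajectory => i; have [si|si] := leqP (size s) i.
  rewrite (_ : (fun _ => _) = cst point)//; apply/funext => w.
  by rewrite nth_default// size_map.
rewrite (_ : (fun _ => _) = Y (nth 0%N s i))//; apply/funext => w.
by rewrite (nth_map 0%N).
Qed.

HB.instance Definition _ :=
  isMeasurableFun.Build _ _ _ _ (sample Y s) measurable_sample.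

End measurable_sample.

Lemma preimage_sample_box (Y : nat -> T -> V) s A :
  (forall i, (size s <= i)%N -> A i point) -> uniq s ->
  sample Y s @^-1` box A = [set w | {in s, forall i, A (index i s) (Y i w)}].
Proof.
move=> Apt us; apply/seteqP; split => w /= wA i; last first.
  have [si|si] := leqP (size s) i.
    by rewrite nth_default ?size_map//; exact: Apt.
  rewrite (nth_map 0%N)//; have := wA (nth 0%N s i).
  by rewrite index_uniq ?mem_nth//; exact.
by move=> si; have := wA (index i s); rewrite (nth_map 0%N) ?index_mem// nth_index.
Qed.

Lemma preimage_sample_box0 (Y : nat -> T -> V) s A :
  ~ (forall i, (size s <= i)%N -> A i point) -> sample Y s @^-1` box A = set0.
Proof.
move=> nApt; apply/seteqP; split => w //= wA; apply: nApt => i si.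
by have := wA i; rewrite nth_default// size_map.
Qed.

Section laws.
Variable mu : set V -> \bar R.

Lemma prob_sample_box Y s A : iid mu Y -> uniq s ->
  (forall i, measurable (A i)) -> (forall i, (size s <= i)%N -> A i point) ->
  P (sample Y s @^-1` box A) = \prod_(i < size s) mu (A i).
Proof.
move=> iidY us mA Apt; rewrite preimage_sample_box// (iidY _ (fun i => A (index i s)))// (big_nth 0%N) big_mkord.
by apply: eq_bigr => i _; rewrite index_uniq.
Qed.

(** Box probabilities are products of values of [mu] that see only the length of the index list.
    This is what permits shifting, reversing, rotating and changing the signs of steps. *)
Lemma eq_sample_law (Y Y' : nat -> {mfun T >-> V}) s s' D :
  iid mu Y -> iid mu Y' -> uniq s -> uniq s' -> size s = size s' ->
  measurable D -> P (sample Y s @^-1` D) = P (sample Y' s' @^-1` D).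
Proof.
move=> iidY iidY' us us' ss' mD.
rewrite -[LHS]/(distribution P (sample Y s) D).
rewrite -[RHS]/(distribution P (sample Y' s') D).
apply: trajectory_measure_unique => //.
  exact: le_lt_trans (probability_le1 _ measurableT) (ltry _).
move=> A mA; rewrite /distribution /pushforward.
have [Apt|nApt] := pselect (forall i, (size s <= i)%N -> A i point).
  transitivity (\prod_(i < size s) mu (A i)); first exact: prob_sample_box.
  rewrite ss'; apply/esym/prob_sample_box => // i.
  by rewrite -ss'; exact: Apt.
transitivity (P set0); last apply/esym; congr (P _).
  exact: preimage_sample_box0.
by apply: preimage_sample_box0; rewrite -ss'.
Qed.

Lemma independent_samples (Y : nat -> {mfun T >-> V}) s t : iid mu Y ->
  uniq (s ++ t) -> independent2 P (sample Y s) (sample Y t).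
Proof.
move=> iidY ust; have := ust; rewrite cat_uniq => /and3P[us st ut].
apply: independent_boxes => A B mA mB.
have [Apt|nApt] := pselect (forall i, (size s <= i)%N -> A i point); last first.
  by rewrite preimage_sample_box0// set0I measure0 mul0e.
have [Bpt|nBpt] := pselect (forall i, (size t <= i)%N -> B i point); last first.
  by rewrite [sample _ t @^-1` _]preimage_sample_box0// setI0 measure0 mule0.
have ts i : i \in t -> i \in s = false.
  by move=> it; apply/negbTE; apply: contra st => si; apply/hasP; exists i.
rewrite !preimage_sample_box//.
(* Since [s] and [t] are disjoint, the two boxes merge into one constraint per index of [s ++ t], to
   which the product rule applies. *)
pose C i := if i \in s then A (index i s) else B (index i t).
have mC i : measurable (C i) by rewrite /C; case: ifP.
transitivity (P [set w | {in s ++ t, forall i, C i (Y i w)}]).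
  congr (P _); apply/seteqP; split => w /=.
    move=> [wA wB] i; rewrite mem_cat /C; case: ifPn => [/wA//|_ /= /wB//].
  move=> wC; split => i ti; have := wC i; rewrite /C mem_cat ti.
    by move=> /(_ isT).
  by rewrite ts// orbT => /(_ isT).
rewrite (iidY _ C)// big_cat /=.
rewrite (iidY _ (fun i => A (index i s)))// (iidY _ (fun i => B (index i t)))//.
congr (_ * _).
  by apply: eq_big_seq => i si; rewrite /C si.
by apply: eq_big_seq => i ti; rewrite /C ts.
Qed.

End laws.
End iid_families.

Arguments sample : simpl never.

(** * Almost sure events and the strict minimum of finitely many variables *)

Section almost_sure_events.
Context d (T : measurableType d) (R : realType) (P : probability T R).

Lemma measurable_ltr_set (f g : T -> R) :
  measurable_fun setT f -> measurable_fun setT g -> measurable [set w | f w < g w].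
Proof.
move=> mf mg; have := measurable_fun_ltr mf mg => /(_ measurableT [set true] I).
by rewrite setTI.
Qed.

Lemma measurable_eqr_set (f g : T -> R) :
  measurable_fun setT f -> measurable_fun setT g -> measurable [set w | f w = g w].
Proof.
move=> mf mg; have := measurable_fun_eqr mf mg => /(_ measurableT [set true] I).
rewrite setTI (_ : _ @^-1` _ = [set w | f w = g w])//.
by apply/seteqP; split => w /=; [move/eqP|move=> ->; exact: eqxx].
Qed.

Lemma measurable_imply_set (Q : Prop) (A : set T) :
  (Q -> measurable A) -> measurable [set w | Q -> A w].
Proof.
move=> mA; have [q|nq] := pselect Q.
  by rewrite (_ : [set _ | _] = A); [exact: mA|apply/seteqP; split => w /=; auto].
by rewrite (_ : [set _ | _] = setT)//; apply/seteqP; split => // w _ /nq.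
Qed.

Lemma measurable_forall_set (A : nat -> set T) :
  (forall j, measurable (A j)) -> measurable [set w | forall j, A j w].
Proof.
move=> mA; rewrite (_ : [set _ | _] = \bigcap_j A j).
  exact: bigcapT_measurable.
by apply/seteqP; split => w /= Aw => [j _|j]; exact: Aw.
Qed.

Lemma ae_imply (Q : Prop) (A : T -> Prop) :
  (Q -> \forall w \ae P, A w) -> \forall w \ae P, Q -> A w.
Proof.
move=> QA; have [q|nq] := pselect Q; last by apply: aeW.
by apply: filterS (QA q).
Qed.

Lemma prob0_ae (A : set T) : measurable A -> P A = 0%E -> \forall w \ae P, ~ A w.
Proof. by move=> mA A0; exists A; split => // w /contrapT. Qed.

Lemma eq_prob_ae (A B : set T) : measurable A -> measurable B ->
  (\forall w \ae P, A w <-> B w) -> P A = P B.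
Proof.
move=> mA mB [N [mN N0 AB]].
have sub (C D : set T) : measurable C -> measurable D ->
    (forall w, C w -> ~ D w -> N w) -> (P C <= P D)%E.
  move=> mC mD CDN; rewrite -[leRHS]adde0 -N0.
  apply: le_trans (measureU2 _ mD mN); apply: le_measure; rewrite ?inE//.
    exact: measurableU.
  by move=> w Cw; have [Dw|nDw] := pselect (D w); [left|right; exact: CDN].
by apply/eqP; rewrite eq_le !sub// => w Cw nDw; apply: AB => /= -[h1 h2]; auto.
Qed.

(** Ties have probability zero, so almost surely exactly one index attains the minimum strictly: the
    events are disjoint and cover the space up to a null set. *)
Lemma sum_prob_argmin (f : nat -> T -> R) m : (0 < m)%N ->
  (forall i, measurable_fun setT (f i)) ->
  (forall i j, (i < j < m)%N -> P [set w | f i w = f j w] = 0%E) ->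
  (\sum_(r < m) P [set w | forall j, (j < m)%N -> j != r -> (f r w < f j w)%R] = 1)%E.
Proof.
case: m => // m _ mf f_neq.
pose Q r := [set w | forall j, (j < m.+1)%N -> j != r -> f r w < f j w].
have mQ r : measurable (Q r).
  apply: measurable_forall_set => j; apply: measurable_imply_set => _.
  by apply: measurable_imply_set => _; exact: measurable_ltr_set.
transitivity (P (\big[setU/set0]_(r < m.+1) Q r)).
  apply/esym/measure_semi_additive_ord_I => //; last exact: bigsetU_measurable.
  apply/trivIsetP => i j /= im jm ij; apply/seteqP; split => w // [wi wj].
  have := lt_trans (wi j jm _) (wj i im ij).
  by rewrite eq_sym ltxx => /(_ ij).
rewrite -(@probability_setT _ _ _ P); apply: eq_prob_ae => //.
  exact: bigsetU_measurable.
have : \forall w \ae P, forall i j, (i < j < m.+1)%N -> f i w <> f j w.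
  apply: ae_foralln => i; apply: ae_foralln => j; apply: ae_imply => ij.
  by apply: prob0_ae (f_neq _ _ ij); exact: measurable_eqr_set.
apply: filterS => w neq; split => // _.
have {}neq i j : (i < m.+1)%N -> (j < m.+1)%N -> i != j -> f i w != f j w.
  move=> im jm; rewrite neq_ltn => /orP[] ij; apply/eqP.
    by apply: neq; rewrite ij.
  by apply/nesym/neq; rewrite ij.
pose g (i : 'I_m.+1) := f i w.
rewrite -bigcup_mkord.
exists (val [arg min_(i < ord0) g i]%O) => /=; first exact: ltn_ord.
case: arg_minP => // i _ imin j jm ji; rewrite lt_neqAle neq// 1?eq_sym//.
exact: (imin (Ordinal jm)).
Qed.

End almost_sure_events.

(** * Planar random walks *)

Section planar_measurability.
Context {R : realType} d (T : measurableType d).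
Implicit Types f g : T -> R * R.

Lemma measurable_addV f g : measurable_fun setT f -> measurable_fun setT g ->
  measurable_fun setT (fun w => f w + g w).
Proof.
move=> /measurable_fun_pairP[f1 f2] /measurable_fun_pairP[g1 g2].
apply/measurable_fun_pairP; split.
  exact: (measurable_funD f1 g1).
exact: (measurable_funD f2 g2).
Qed.

Lemma measurable_oppV f : measurable_fun setT f ->
  measurable_fun setT (fun w => - f w).
Proof.
move=> /measurable_fun_pairP[f1 f2].
apply/measurable_fun_pairP; split.
  exact: (measurable_funN f1).
exact: (measurable_funN f2).
Qed.

Lemma measurable_det f g : measurable_fun setT f -> measurable_fun setT g ->
  measurable_fun setT (fun w => det (f w) (g w)).
Proof.
move=> /measurable_fun_pairP[f1 f2] /measurable_fun_pairP[g1 g2].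
apply: measurable_funB.
  exact: (measurable_funM f1 g2).
exact: (measurable_funM f2 g1).
Qed.

Lemma measurable_dot f g : measurable_fun setT f -> measurable_fun setT g ->
  measurable_fun setT (fun w => dot (f w) (g w)).
Proof.
move=> /measurable_fun_pairP[f1 f2] /measurable_fun_pairP[g1 g2].
apply: measurable_funD.
  exact: (measurable_funM f1 g1).
exact: (measurable_funM f2 g2).
Qed.

Lemma measurable_sumV (f : nat -> T -> R * R) n :
  (forall i, measurable_fun setT (f i)) ->
  measurable_fun setT (fun w => \sum_(i < n) f i w).
Proof.
move=> mf; elim: n => [|n IH].
  by under eq_fun do rewrite big_ord0; exact: measurable_cst.
by under eq_fun do rewrite big_ord_recr; exact: measurable_addV.
Qed.

Lemma measurable_neq0_set f : measurable_fun setT f ->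
  measurable [set w | f w != 0].
Proof.
move=> mf; rewrite (_ : [set _ | _] = [set w | 0 < dot (f w) (f w)]).
  by apply: measurable_ltr_set => //; exact: measurable_dot.
by apply/seteqP; split => w /=; rewrite dot_gt0.
Qed.

End planar_measurability.

Section trajectory_sums.
Context {R : realType}.

(** The default [0] is also the [point] of [R * R], so the padding of trajectories adds nothing to
    the sums. *)
Definition psum (j : nat) (x : trajectory (R * R)%type) : R * R :=
  \sum_(i < j) nth 0 x i.

Lemma measurable_psum j : measurable_fun setT (psum j).
Proof.
exact: (@measurable_sumV R _ (trajectory (R * R)%type) (fun i x => nth 0 x i) j
  (fun i => measurable_nth i)).
Qed.

Lemma psum_sample d (T : measurableType d) (Y : nat -> T -> R * R) s j w :
  psum j (sample Y s w) = \sum_(i <- take j s) Y i w.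
Proof.
rewrite /psum /sample; elim: s j => [|i s IH] [|j] /=.
- by rewrite big_ord0 big_nil.
- by rewrite big_nil big1// => k _; rewrite nth_nil.
- by rewrite big_ord0 big_nil.
- by rewrite big_ord_recl big_cons /= -IH.
Qed.

Definition positive_walk (v : R * R) m : set (trajectory (R * R)%type) :=
  [set x | forall j, (1 <= j <= m)%N -> 0 < det v (psum j x)].

Definition positive_bridge k : set (trajectory (R * R)%type) :=
  [set x | forall j, (1 <= j < k)%N -> 0 < det (psum k x) (psum j x)].

Lemma measurable_positive_walk v m : measurable (positive_walk v m).
Proof.
apply: measurable_forall_set => j; apply: measurable_imply_set => _.
by apply: measurable_ltr_set => //; apply: measurable_det => //; exact: measurable_psum.
Qed.

Lemma measurable_positive_bridge k : measurable (positive_bridge k).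
Proof.
apply: measurable_forall_set => j; apply: measurable_imply_set => _.
by apply: measurable_ltr_set => //; apply: measurable_det; exact: measurable_psum.
Qed.

End trajectory_sums.

Section signed_family.
Context {R : realType} d (T : measurableType d) (P : probability T R).

Definition signed (X : nat -> T -> R * R) (e : pred nat) i w :=
  if e i then - X i w else X i w.

Section measurable_signed.
Variables (X : nat -> {mfun T >-> (R * R)%type}) (e : pred nat) (i : nat).

Lemma measurable_signed : measurable_fun setT (signed X e i).
Proof.
rewrite /signed; case: (e i) => //.
exact: measurable_oppV.
Qed.

HB.instance Definition _ :=
  isMeasurableFun.Build _ _ _ _ (signed X e i) measurable_signed.

End measurable_signed.

(** A sign change of a step is moved to its constraint set, whose [mu]-value is unchanged by
    symmetry. *)
Lemma iid_signed (mu : set (R * R) -> \bar R) (X : nat -> T -> R * R) e :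
  (forall A : set (R * R), measurable A -> mu [set x | A (- x)] = mu A) ->
  iid P mu X -> iid P mu (signed X e).
Proof.
move=> mu_opp iidX s A us mA.
pose A' i := if e i then [set x | A i (- x)] else A i.
have mA' i : measurable (A' i).
  rewrite /A'; case: (e i) => //.
  have := measurable_oppV (@measurable_id _ (R * R)%type setT).
  by move=> /(_ measurableT _ (mA i)); rewrite setTI.
transitivity (P [set w | {in s, forall i, A' i (X i w)}]).
  congr (P _); apply/seteqP; split => w /= wA i /wA;
    by rewrite /A' /signed; case: (e i).
rewrite (iidX _ A')//; apply: eq_bigr => i _.
by rewrite /A'; case: (e i) => //; exact: mu_opp.
Qed.

End signed_family.

(** * Probabilities for walks whose step law is symmetric and does not charge lines *)

Section planar_walk.
Context {R : realType} d (T : measurableType d) (P : probability T R).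
Variables (mu : set (R * R) -> \bar R) (X : nat -> {RV P >-> (R * R)%type}).
Hypothesis iidX : iid P mu X.
Hypothesis mu_line : forall (v : R * R) c, v != 0 -> mu [set y | det v y = c] = 0%E.
Hypothesis mu_opp : forall A : set (R * R),
  measurable A -> mu [set x | A (- x)] = mu A.

Local Notation S := (partial_sum X).

Lemma sum_iota a b w : \sum_(i <- iota a b) X i w = S (a + b) w - S a w.
Proof.
have SE k : S k w = \sum_(0 <= i < k) X i w by rewrite big_mkord.
rewrite !SE (@big_cat_nat _ _ _ a)//= ?leq_addr// addrAC subrr add0r.
by rewrite /index_iota addKn.
Qed.

Lemma sum_iota0 k w : \sum_(i <- iota 0 k) X i w = S k w.
Proof. by rewrite sum_iota [S 0 w]big_ord0 subr0. Qed.

Lemma measurable_partial_sum k : measurable_fun setT (S k).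
Proof. by apply: (@measurable_sumV R _ T X k). Qed.

Lemma measurable_sum_seq s : measurable_fun setT (fun w => \sum_(i <- s) X i w).
Proof.
have -> : (fun w => \sum_(i <- s) X i w) = psum (size s) \o sample X s.
  by apply/funext => w; rewrite /= psum_sample take_size.
apply: measurableT_comp; first exact: measurable_psum.
exact: measurable_sample.
Qed.

Lemma prob_line i (v : R * R) c : v != 0 -> P [set w | det v (X i w) = c] = 0%E.
Proof.
move=> v0; have mL : measurable [set y : R * R | det v y = c].
  by apply: measurable_eqr_set => //; exact: measurable_det.
have := iidX (isT : uniq [:: i]) (fun=> mL); rewrite big_seq1 mu_line// => <-.
congr (P _); apply/seteqP; split => w /= wL => [j|]; last by apply: wL; rewrite inE.
by rewrite inE => /eqP ->.
Qed.

(** Once all steps but one are fixed, the remaining step would have to fall on a given line parallel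
    to [v]. *)
Lemma prob_sum_line s (v : R * R) : uniq s -> s != [::] -> v != 0 ->
  P [set w | det v (\sum_(i <- s) X i w) = 0] = 0%E.
Proof.
case: s => // i s uis _ v0.
have indep : independent2 P (sample X s) (sample X [:: i]).
  apply: (independent_samples iidX).
  by rewrite -[s ++ _]/(s ++ [:: i]) cats1 rcons_uniq.
pose D := [set xy : trajectory (R * R)%type * trajectory (R * R)%type |
  det v (psum 1 xy.2 + psum (size s) xy.1) = 0].
have mD : measurable D.
  apply: measurable_eqr_set => //; apply: measurable_det => //.
  by apply: measurable_addV; (apply: measurableT_comp; first exact: measurable_psum).
have := independent_condition indep measurableT mD (q := 0%E).
rewrite mul0e => <-; last first.
  move=> x _; rewrite -(prob_line i (- det v (psum (size s) x)) v0).
  congr (P _); apply/seteqP; split => w; rewrite /D /= psum_sample /= big_seq1.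
    by rewrite detDr => /eqP; rewrite addr_eq0 => /eqP.
  by rewrite detDr => ->; rewrite addNr.
congr (P _); apply/seteqP; split => w; rewrite /D /= !psum_sample take_size big_cons /=.
  by rewrite big_seq1.
by rewrite big_seq1 => -[].
Qed.

Lemma prob_sum_eq0 s : uniq s -> s != [::] ->
  P [set w | ~ (\sum_(i <- s) X i w != 0)] = 0%E.
Proof.
(* Any nonzero direction would do: a vanishing sum lies on every line through the origin. *)
move=> us s0; have e0 : (1, 0) != 0 :> R * R by rewrite xpair_eqE oner_eq0.
apply: subset_measure0 (prob_sum_line us s0 e0).
- apply: measurableC; apply: measurable_neq0_set; exact: measurable_sum_seq.
- apply: measurable_eqr_set => //; apply: measurable_det => //.
  exact: measurable_sum_seq.
- by move=> w /= /negP; rewrite negbK => /eqP ->; rewrite det0r.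
Qed.

Lemma ae_sum_neq0 s : uniq s -> s != [::] ->
  \forall w \ae P, \sum_(i <- s) X i w != 0.
Proof.
move=> us s0; have := prob0_ae _ (prob_sum_eq0 us s0).
have /[swap]/[apply] : measurable [set w | ~ (\sum_(i <- s) X i w != 0)].
  apply: measurableC; apply: measurable_neq0_set; exact: measurable_sum_seq.
by apply: filterS => w /contrapT.
Qed.

Lemma prob_det_sums s t : uniq (s ++ t) -> s != [::] -> t != [::] ->
  P [set w | det (\sum_(i <- s) X i w) (\sum_(i <- t) X i w) = 0] = 0%E.
Proof.
move=> ust s0 t0; have := ust; rewrite cat_uniq => /and3P[us _ ut].
have indep := independent_samples iidX ust.
(* Conditioning on the first sum, it serves as the direction of a line, so it must be nonzero; this
   holds almost surely. *)
pose A := [set x : trajectory (R * R)%type | psum (size s) x != 0].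
have mA : measurable A by apply: measurable_neq0_set; exact: measurable_psum.
pose D := [set xy : trajectory (R * R)%type * trajectory (R * R)%type |
  det (psum (size s) xy.1) (psum (size t) xy.2) = 0].
have mD : measurable D.
  apply: measurable_eqr_set => //.
  by apply: measurable_det; (apply: measurableT_comp; first exact: measurable_psum).
have := independent_condition indep mA mD (q := 0%E).
rewrite mul0e => <-; last first.
  move=> x Ax; rewrite -(prob_sum_line ut t0 Ax).
  by congr (P _); apply/seteqP; split => w; rewrite /D /= psum_sample take_size.
apply: eq_prob_ae.
- apply: measurable_eqr_set => //.
  by apply: measurable_det; exact: measurable_sum_seq.
- apply: measurableI; first exact: measurable_preimage.
  have mst : measurable_fun setT (fun w => (sample X s w, sample X t w)).
    by apply: measurable_fun_pair; exact: measurable_sample.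
  by have := mst measurableT _ mD; rewrite setTI.
- apply: filterS (ae_sum_neq0 us s0) => w w0.
  rewrite /A /D /= !psum_sample !take_size; split=> [//|[]//].
Qed.

(** For fixed [v] the probability depends only on the number of steps, also after sign changes.
    Splitting at the time of the minimum of [det v (S j)] yields the convolution identity that
    characterizes [dfact_ratio]. *)
Lemma prob_positive_walk (v : R * R) s : v != 0 -> uniq s ->
  P (sample X s @^-1` positive_walk v (size s)) = (dfact_ratio (size s))%:E.
Proof.
move=> v0; pose p m := P (sample X (iota 0 m) @^-1` positive_walk v m).
have mpos := @measurable_positive_walk R v.
have pE (Y : nat -> {RV P >-> (R * R)%type}) t : iid P mu Y -> uniq t ->
    P (sample Y t @^-1` positive_walk v (size t)) = p (size t).
  move=> iidY ut; apply: (eq_sample_law iidY iidX) => //.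
    exact: iota_uniq.
  by rewrite size_iota.
move=> us; rewrite pE//; move: (size s) => {s us} m.
have p_fin k : p k \is a fin_num.
  by apply: fin_num_measure; exact: measurable_preimage.
rewrite -(fineK (p_fin m)); congr (_%:E).
apply: (dfact_ratio_unique (p := fine \o p)) => /=.
  rewrite /p (_ : _ @^-1` _ = setT) ?probability_setT//.
  by apply/seteqP; split => // w _ [].
move=> {}m m0; apply: EFin_inj; rewrite -sumEFin.
pose f j w := det v (S j w).
have mf j : measurable_fun setT (f j).
  by apply: measurable_det => //; exact: measurable_partial_sum.
(* A tie means that the sum of the steps from [i] to [j - 1] lies on the line through the origin
   along [v]. *)
have neq i j : (i < j < m.+1)%N -> P [set w | f i w = f j w] = 0%E.
  move=> /andP[ij _].
  have := prob_sum_line (iota_uniq i (j - i)) _ v0.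
  rewrite -size_eq0 size_iota subn_eq0 -ltnNge ij => /(_ isT) <-.
  congr (P _); apply/seteqP; split => w; rewrite /f /= sum_iota subnKC 1?ltnW// detBr.
    by move=> ->; rewrite subrr.
  by move=> /eqP; rewrite subr_eq0 => /eqP.
rewrite -(sum_prob_argmin (ltn0Sn m) mf neq); apply: eq_bigr => r _.
have rm : (r <= m)%N by rewrite -ltnS.
rewrite EFinM !fineK//.
(* Seen from the time [r] of the minimum, the walk is positive both forwards
   and, with reversed and negated steps, backwards. *)
pose Y := signed X (fun i => (i < r)%N).
have iidY : iid P mu Y by apply: iid_signed.
have pEr : p r = P (sample Y (rev (iota 0 r)) @^-1` positive_walk v r).
  have := pE Y (rev (iota 0 r)) iidY.
  by rewrite rev_uniq iota_uniq size_rev size_iota => ->.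
have pEmr : p (m - r)%N = P (sample Y (iota r (m - r)) @^-1` positive_walk v (m - r)).
  by have := pE Y (iota r (m - r)) iidY; rewrite iota_uniq size_iota => ->.
have ust : uniq (rev (iota 0 r) ++ iota r (m - r)).
  rewrite cat_uniq rev_uniq !iota_uniq andbT /=; apply/hasPn => i.
  by rewrite mem_iota mem_rev mem_iota /= add0n -leqNgt => /andP[].
rewrite pEr pEmr -(independent_samples iidY ust)//; congr (P _).
have back j w : (j <= r)%N ->
    psum j (sample Y (rev (iota 0 r)) w) = S (r - j) w - S r w.
  move=> jr; rewrite psum_sample take_rev size_iota drop_iota add0n subKn//.
  rewrite (eq_big_seq (fun i => - X i w)); last first.
    move=> i; rewrite mem_rev mem_iota subnK// /Y /signed => /andP[_ ->]//.
  rewrite sumrN (perm_big (iota (r - j) j)) ?perm_rev//=.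
  by rewrite sum_iota subnK// opprB.
have forth j w : (j <= m - r)%N ->
    psum j (sample Y (iota r (m - r)) w) = S (r + j) w - S r w.
  move=> jmr; rewrite psum_sample take_iota (minn_idPl jmr) -sum_iota.
  apply: eq_big_seq => i; rewrite mem_iota /Y /signed => /andP[ri _].
  by rewrite ltnNge ri.
apply/seteqP; split => w /=.
  move=> [pos1 pos2] j; rewrite ltnS => jm jr.
  move: jr; rewrite neq_ltn => /orP[jr|rj].
    have := pos1 (r - j)%N; rewrite subn_gt0 jr leq_subr back ?leq_subr//.
    by rewrite subKn 1?ltnW// detBr subr_gt0; apply.
  have := pos2 (j - r)%N; rewrite subn_gt0 rj leq_sub2r// forth ?leq_sub2r//.
  by rewrite subnKC 1?ltnW// detBr subr_gt0; apply.
move=> argmin; split => j /andP[j0 jr].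
  rewrite back// detBr subr_gt0; apply: argmin; first by lia.
  by apply/eqP; lia.
rewrite forth// detBr subr_gt0; apply: argmin; first by lia.
by apply/eqP; lia.
Qed.

(* The [k] cyclic shifts of [X_0, ..., X_(k-1)] have the same law, and the
   shift starting at time [r] is a positive bridge exactly when [r] is the time
   at which [det (S k) (S j)] is minimal. *)
Lemma prob_positive_bridge k : (0 < k)%N ->
  P (sample X (iota 0 k) @^-1` positive_bridge k) = (k%:R^-1)%:E.
Proof.
move=> k0; set p := P _.
pose f j w := det (S k w) (S j w).
have mf j : measurable_fun setT (f j).
  by apply: measurable_det; exact: measurable_partial_sum.
have neq i j : (i < j < k)%N -> P [set w | f i w = f j w] = 0%E.
  move=> /andP[ij jk].
  (* The difference [f j - f i] is the determinant of [S k] with the sum of the inner steps.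
     Removing the inner steps from [S k] does not change it, which leaves two sums over disjoint
     index sets. *)
  have outer_nil : iota 0 i ++ iota j (k - j) != [::].
    by rewrite -size_eq0 size_cat !size_iota; lia.
  have inner_nil : iota i (j - i) != [::] by rewrite -size_eq0 size_iota; lia.
  rewrite -(prob_det_sums _ outer_nil inner_nil); last first.
    have /perm_uniq -> : perm_eq ((iota 0 i ++ iota j (k - j)) ++ iota i (j - i))
        (iota 0 i ++ iota i (j - i) ++ iota j (k - j)).
      by rewrite -catA perm_cat2l perm_catC.
    rewrite -[X in iota X (k - j)](subnKC (ltnW ij)) -iotaD.
    by rewrite -[X in iota X (_ + _)]add0n -iotaD iota_uniq.
  have detE w : det (\sum_(l <- iota 0 i ++ iota j (k - j)) X l w)
      (\sum_(l <- iota i (j - i)) X l w) = f j w - f i w.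
    rewrite big_cat /= !sum_iota !subnKC 1?ltnW// add0n [S 0 w]big_ord0 subr0.
    by rewrite /f /det /=; ring.
  congr (P _); apply/seteqP; split => w /=; rewrite detE.
    by move=> ->; rewrite subrr.
  by move=> /eqP; rewrite subr_eq0 => /eqP.
have sum_p : (\sum_(r < k) p = 1)%E.
  rewrite -(sum_prob_argmin k0 mf neq); apply: eq_bigr => r _.
  have -> : p = P (sample X (rot r (iota 0 k)) @^-1` positive_bridge k).
    apply: (eq_sample_law iidX iidX); rewrite ?rot_uniq ?iota_uniq ?size_rot//.
    exact: measurable_positive_bridge.
  congr (P _).
  have rk := ltn_ord r.
  have rotE : rot r (iota 0 k) = iota r (k - r) ++ iota 0 r.
    by rewrite /rot drop_iota take_iota (minn_idPl (ltnW rk)).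
  have early j w : (j <= k - r)%N ->
      psum j (sample X (rot r (iota 0 k)) w) = S (r + j) w - S r w.
    move=> jkr; rewrite psum_sample rotE takel_cat ?size_iota//.
    by rewrite take_iota (minn_idPl jkr) sum_iota.
  have late j w : (k - r <= j)%N -> (j <= k)%N ->
      psum j (sample X (rot r (iota 0 k)) w) =
      S k w - S r w + S (j - (k - r)) w.
    move=> krj jk; rewrite psum_sample rotE take_cat size_iota ltnNge krj /=.
    rewrite big_cat take_iota sum_iota subnKC 1?ltnW//= (minn_idPl _) ?sum_iota0//.
    by lia.
  have total w : psum k (sample X (rot r (iota 0 k)) w) = S k w.
    by rewrite late ?leq_subr// subKn 1?ltnW// subrK.
  apply/seteqP; split => w /=.
    move=> pos j jk; rewrite neq_ltn => /orP[jr|rj].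
      (* For [j < r] the rotated walk meets time [j] after the wrap, at its step [j + (k - r)]; the
         extra summand [S k] there has zero determinant with the endpoint [S k]. *)
      have := pos (j + (k - r))%N; rewrite total late ?leq_addl//; last by lia.
      rewrite addnK detDr detBr detxx sub0r addrC subr_gt0; apply.
      by lia.
    have jkr : (j - r <= k - r)%N by lia.
    have := pos (j - r)%N; rewrite total (early _ _ jkr) (subnKC (ltnW rj)).
    by rewrite detBr subr_gt0; apply; lia.
  move=> argmin j /andP[j0 jk]; rewrite total.
  have [jkr|krj] := ltnP j (k - r).
    rewrite early 1?ltnW// detBr subr_gt0; apply: argmin; first by lia.
    by apply/eqP; lia.
  rewrite (late _ _ krj (ltnW jk)) detDr detBr detxx sub0r addrC subr_gt0.
  by apply: argmin; [lia|apply/eqP; lia].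
have p_fin : p \is a fin_num.
  apply: fin_num_measure; apply: measurable_preimage.
  exact: measurable_positive_bridge.
have k0' : k%:R != 0 :> R by rewrite pnatr_eq0 -lt0n.
rewrite -(fineK p_fin); congr (_%:E); apply: (mulIf k0').
rewrite mulVf// mulr_natr -[k in _ *+ k]card_ord -sumr_const; apply: EFin_inj.
by rewrite -sumEFin -sum_p; apply: eq_bigr => r _; rewrite fineK.
Qed.

(** The strict inequalities make these events disjoint for different [k]; a nonzero [S k w] lies on
    its own open ray. *)
Definition leftmost (n k : nat) : set T :=
  [set w | S k w != 0 /\
    forall j, (1 <= j <= n)%N -> j != k -> 0 < det (S k w) (S j w)].

Lemma measurable_leftmost n k : measurable (leftmost n k).
Proof.
apply: measurableI.
  by apply: measurable_neq0_set; exact: measurable_partial_sum.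
apply: measurable_forall_set => j; do 2 apply: measurable_imply_set => _.
by apply: measurable_ltr_set => //; apply: measurable_det; exact: measurable_partial_sum.
Qed.

Lemma prob_leftmost n k : (1 <= k <= n)%N ->
  P (leftmost n k) = (dfact_ratio (n - k) / k%:R)%:E.
Proof.
move=> /andP[k0 kn]; set m := (n - k)%N.
have ust : uniq (iota 0 k ++ iota k m) by rewrite -[k in iota k]add0n -iotaD iota_uniq.
have indep := independent_samples iidX ust.
(* The bridge condition is joined with a nonzero endpoint, an almost sure event, so that the
   endpoint can be the direction [v] of [prob_positive_walk] for the remaining steps. *)
pose A := [set x : trajectory (R * R)%type | psum k x != 0] `&` positive_bridge k.
have mA : measurable A.
  apply: measurableI; last exact: measurable_positive_bridge.
  by apply: measurable_neq0_set; exact: measurable_psum.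
pose D := [set xy : trajectory (R * R)%type * trajectory (R * R)%type |
  forall j, (1 <= j <= m)%N -> 0 < det (psum k xy.1) (psum j xy.2)].
have mD : measurable D.
  apply: measurable_forall_set => j; apply: measurable_imply_set => _.
  apply: measurable_ltr_set => //.
  by apply: measurable_det; (apply: measurableT_comp; first exact: measurable_psum).
have := independent_condition indep mA mD (q := (dfact_ratio m)%:E).
have -> : P (sample X (iota 0 k) @^-1` A) = (k%:R^-1)%:E.
  rewrite -prob_positive_bridge//; apply: eq_prob_ae.
  - exact: measurable_preimage.
  - by apply: measurable_preimage; exact: measurable_positive_bridge.
  have k_nil : iota 0 k != [::] by rewrite -size_eq0 size_iota -lt0n.
  apply: filterS (ae_sum_neq0 (iota_uniq 0 k) k_nil) => w w0.
  rewrite /A /= psum_sample take_oversize ?size_iota//.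
  by split => [[]//|]; split.
rewrite -EFinM => <-; last first.
  move=> x [x0 _]; have := prob_positive_walk x0 (iota_uniq k m).
  by rewrite size_iota => <-.
have sumk w : psum k (sample X (iota 0 k) w) = S k w.
  by rewrite psum_sample take_oversize ?size_iota// sum_iota0.
have sum1 j w : (j <= k)%N -> psum j (sample X (iota 0 k) w) = S j w.
  by move=> jk; rewrite psum_sample take_iota (minn_idPl jk) sum_iota0.
have sum2 j w : (j <= m)%N -> psum j (sample X (iota k m) w) = S (k + j) w - S k w.
  by move=> jm; rewrite psum_sample take_iota (minn_idPl jm) sum_iota.
congr (P _); apply/seteqP; split => w; rewrite /A /D /= /positive_bridge /= sumk.
  move=> [Sk0 left]; split; [split => //|] => j /andP[j0 jk].
    by rewrite sum1 1?ltnW//; apply: left; [lia|apply/eqP; lia].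
  rewrite sum2// detBr detxx subr0; apply: left; first by lia.
  by apply/eqP; lia.
move=> [[Sk0 left] right]; split => // j /andP[j0 jn]; rewrite neq_ltn => /orP[jk|kj].
  by have := left j; rewrite (sum1 _ _ (ltnW jk)) j0 jk; apply.
have := right (j - k)%N; rewrite (sum2 _ _ (leq_sub2r k jn)) (subnKC (ltnW kj)).
by rewrite detBr detxx subr0; apply; lia.
Qed.

(** Off a null set no two of the partial sums are collinear with the origin. There the weak
    condition [left_side] for some [k] amounts to membership in one of the disjoint events
    [leftmost n k], whose probabilities add up. *)
Lemma prob_not_convex_hull0 n : (0 < n)%N ->
  P [set w | ~ convex_hull [set S k w | k in [set k | (1 <= k <= n)%N]] 0] =
  (\sum_(1 <= k < n.+1) dfact_ratio (n - k) / k%:R)%:E.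
Proof.
move=> n0; pose F k := leftmost n k.+1.
have mF k : measurable (F k) by exact: measurable_leftmost.
transitivity (P (\big[setU/set0]_(k < n) F k)); last first.
  rewrite measure_semi_additive_ord_I//; last exact: bigsetU_measurable.
    rewrite big_add1 /= big_mkord -sumEFin; apply: eq_bigr => k _.
    by rewrite prob_leftmost//= ltn_ord.
  (* Membership in two of the events would make a determinant and its opposite both positive. *)
  apply/trivIsetP => i j /= im jm ij; apply/seteqP; split => w // [[_ wi] [_ wj]].
  have := wi j.+1 jm; have := wj i.+1 im; rewrite !eqSS ij eq_sym ij => /(_ isT) h /(_ isT).
  by rewrite detC oppr_gt0 ltNge ltW.
have -> : [set w | ~ convex_hull [set S k w | k in [set k | (1 <= k <= n)%N]] 0] =
    [set w | exists2 k, (1 <= k <= n)%N &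
      forall j, (1 <= j <= n)%N -> left_side (S k w) (S j w)].
  by apply/seteqP; split => w /= /(not_convex_hull0P (S ^~ w) n0).
apply: eq_prob_ae.
- rewrite (_ : [set _ | _] = \big[setU/set0]_(k < n)
      [set w | forall j, (1 <= j <= n)%N -> left_side (S k.+1 w) (S j w)]).
    apply: bigsetU_measurable => k _.
    apply: measurable_forall_set => j; apply: measurable_imply_set => _.
    have mS i := measurable_partial_sum i.
    apply: measurableU; first by apply: measurable_ltr_set => //; exact: measurable_det.
    apply: measurableI; first by apply: measurable_eqr_set => //; exact: measurable_det.
    by apply: measurable_ltr_set => //; exact: measurable_dot.
  rewrite -(bigcup_mkord n (fun k => [set w | forall j, (1 <= j <= n)%N ->
    left_side (S k.+1 w) (S j w)])).
  apply/seteqP; split => w /=; first by move=> [[//|k] kn kP]; exists k.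
  by move=> [k kn kP]; exists k.+1.
- exact: bigsetU_measurable.
have : \forall w \ae P, forall i j, (1 <= i < j)%N -> det (S i w) (S j w) <> 0.
  apply: ae_foralln => i; apply: ae_foralln => j; apply: ae_imply => /andP[i0 ij].
  apply: prob0_ae.
    by apply: measurable_eqr_set => //; apply: measurable_det; exact: measurable_partial_sum.
  (* Replacing [S j] by [S j - S i] keeps the determinant with [S i] and leaves sums over two
     disjoint blocks of steps. *)
  have := @prob_det_sums (iota 0 i) (iota i (j - i)).
  rewrite -[i in iota i]add0n -iotaD iota_uniq -!size_eq0 !size_iota -lt0n i0.
  rewrite subn_eq0 -ltnNge ij => /(_ isT isT isT) <-.
  congr (P _); apply/seteqP; split => w /=;
    by rewrite sum_iota0 sum_iota (subnKC (ltnW ij)) detBr detxx subr0.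
apply: filterS => w neq; rewrite -bigcup_mkord; split.
  move=> [[//|k] kn kP]; exists k => //; split.
    by have := kP _ kn; rewrite -dot_gt0 => -[|[]//]; rewrite detxx ltxx.
  move=> j jn; rewrite neq_ltn => /orP[jk|kj]; have [//|[det0 _]] := kP j jn.
    by case: (@neq j k.+1) => //; [lia|rewrite detC det0 oppr0].
  by case: (@neq k.+1 j).
move=> [k kn [Sk0 kP]]; exists k.+1 => // j jn.
have [->|jk] := eqVneq j k.+1; last by left; exact: kP.
by right; rewrite detxx dot_gt0.
Qed.

End planar_walk.

Section planar_steps.
Context {R : realType} d (T : measurableType d) (P : probability T R).
Variable X : nat -> {RV P >-> (R * R)%type}.

Lemma iid_independent_RVs : independent_RVs X ->
  (forall i, equal_in_distribution P (X i) (X 0%N)) ->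
  iid P (fun A => P (X 0%N @^-1` A)) X.
Proof.
move=> indepX identX s A us mA.
have := indepX [fset i | i in s]%fset A mA.
rewrite (perm_big s) /=; last first.
  by apply: uniq_perm => [|//|i]; [exact: fset_uniq|rewrite !inE].
rewrite (eq_bigr (fun i => P (X 0%N @^-1` A i))) => [<-|i _]; last exact: identX.
congr (P _); apply/seteqP; split => w /= wA i.
  by rewrite /= !inE => /wA.
by move=> si; apply: wA; rewrite /= !inE.
Qed.

Lemma affine_line_det (v : R * R) c : v != 0 ->
  affine_line [set y | det v y = c].
Proof.
case: v => v1 v2 v0.
have vv : v1 ^+ 2 + v2 ^+ 2 != 0.
  by have := dot_gt0 (v1, v2); rewrite v0 /dot /= -!expr2 => /lt0r_neq0.
(* The line has direction [v]; its base point is a multiple of [v] turned by a quarter, scaled so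
   that its determinant with [v] is [c]. *)
exists (c / (v1 ^+ 2 + v2 ^+ 2) *: (- v2, v1)), (v1, v2); split => //.
apply/seteqP; split => [[y1 y2]|_ [t _ <-]]; rewrite /det /=.
  (* The parameter is the coefficient of the orthogonal projection onto [v]. *)
  move=> <-; exists ((v1 * y1 + v2 * y2) / (v1 ^+ 2 + v2 ^+ 2)) => //.
  by congr (_, _); rewrite /= /GRing.scale /=; field.
by rewrite /GRing.scale /=; field.
Qed.

End planar_steps.

Theorem theorem1 (R : realType) (d : measure_display) (T : measurableType d)
    (P : probability T R) (X : nat -> {RV P >-> (R * R)%type})
    (X_indep : independent_RVs X)
    (X_ident : forall i : nat, equal_in_distribution P (X i) (X 0%N))
    (X_lines : forall h : set (R * R), affine_line h -> P (X 0%N @^-1` h) = 0%E)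
    (X_sym : equal_in_distribution P (X 0%N) (fun w : T => - (X 0%N w)))
    (n : nat) (n_ge1 : (1 <= n)%N) :
  P [set w : T | ~ convex_hull
       [set partial_sum X k w | k in [set k : nat | (1 <= k <= n)%N]] 0] =
  (\sum_(1 <= k < n.+1)
     (odd_double_factorial (n - k))%:R /
     (k%:R * (even_double_factorial (n - k))%:R) : R)%:E.
Proof.
have iidX := iid_independent_RVs X_indep X_ident.
rewrite (prob_not_convex_hull0 iidX) //.
- congr (_%:E); apply: eq_bigr => k _.
  by rewrite /dfact_ratio mulrAC -mulrA -invfM.
- by move=> v c v0; exact/X_lines/affine_line_det.
- by move=> A mA; rewrite -X_sym.
Qed.
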